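(* Assume $S$ is symmetric. Then there exist polynomials $N^+(z),N^-(z)\in K[z]$ and $\widetilde N^+(u,z),\widetilde N^-(u,z)\in K[u,z]$ such that, as formal power series, $$\sum_{k\ge0}F_k^+z^k=\frac{N^+(z)}{D(z^2)},\qquad \sum_{k\ge0}F_k^-z^k=\frac{N^-(z)}{D(z^2)},$$ $$\sum_{k\ge0}\ \sum_{0\le\ell\le k/2}F^+_{k,\ell}u^\ell z^k=\frac{\widetilde N^+(u,z)}{\widetilde D(uz^2)D(z^2)},\qquad \sum_{k\ge0}\ \sum_{0\le\ell<k/2}F^-_{k,\ell}u^\ell z^k=\frac{\widetilde N^-(u,z)}{\widetilde D(uz^2)D(z^2)}.$$
   Context: Let $S$ be a finite set of integers with $a:=\max S\ge1$ and $b:=-\min S$; each $s\in S$ carries a weight $\omega_s$ in a field $K$ of characteristic $0$; set $\omega_s:=0$ for $s\notin S$. $S$ is called symmetric if $-S=S$ and $\omega_{-s}=\omega_s$ for all $s\in S$ (so $b=a$). For $s\in\mathbb Z$ put $\beta_s:=\delta_{s,0}-\omega_s$ and $\widetilde\beta_s:=-\beta_{s+1}$. Notation: $[m,n]:=\{i\in\mathbb Z: m\le i\le n\}$, $X+c:=\{x+c:x\in X\}$; an $n$-subset is a subset of cardinality $n$; for a finite $I\subseteq\mathbb Z$ and $s\in\mathbb Z$, $\epsilon_s(I):=(-1)^{\#\{i\in I:\ i<s\}}$. $\mathbf T$ is the square matrix indexed by the $a$-subsets of $[-b,a-1]$ with $\mathbf T[I,J]:=\epsilon_s(I)\beta_s$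 if there is an integer $s$ with $I\cup\{a\}=(J+1)\cup\{s\}$, and $0$ otherwise; $\widetilde{\mathbf T}$ is the square matrix indexed by the $(a-1)$-subsets of $[-b-1,a-2]$ with $\widetilde{\mathbf T}[I,J]:=\epsilon_s(I)\widetilde\beta_s$ if there is an integer $s$ with $I\cup\{a-1\}=(J+1)\cup\{s\}$, and $0$ otherwise. $D(z):=\det(1-z\mathbf T)$ and $\widetilde D(z):=\det(1-z\widetilde{\mathbf T})$. For $k\ge0$, $A_k^+$ is the matrix with rows and columns indexed by the integers $0\le i,j\le k/2$ and entries $\omega_{j-i}+\omega_{k-j-i}$ if $j<k/2$ and $\omega_{j-i}$ if $j=k/2$; $A_k^-$ is the matrix with rows and columns indexed by the integers $0\le i,j<k/2$ and entries $\omega_{j-i}-\omega_{k-j-i}$. The determinant of an empty matrix is $1$. Put $F^\pm_0:=1$ and $F^\pm_k:=\det(1-A^\pm_{k-1})$ for $k\ge1$. For an index $\ell$ of $A^\pm_k$, $F^\pm_{k,\ell}$ is the $(\ell,0)$ cofactor of $1-A_k^\pm$, i.e. $(-1)^\ell$ times the determinant of $1-A_k^\pm$ with row $\ell$ and column $0$ deleted. *)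

(* Defs.v *)
From HB Require Import structures.
From mathcomp Require Import all_boot all_order all_algebra.
Set Implicit Arguments. Unset Strict Implicit. Unset Printing Implicit Defensive.
Import Order.TTheory GRing.Theory Num.Theory.
Local Open Scope ring_scope.

Section Defs.
Variable K : fieldType.

Definition omega (S : seq int) (w : int -> K) (s : int) : K :=
  if s \in S then w s else 0.

Definition beta (S : seq int) (w : int -> K) (s : int) : K :=
  (s == 0)%:R - omega S w s.

Definition betat (S : seq int) (w : int -> K) (s : int) : K :=
  - beta S w (s + 1).

(* m-subsets of an interval of N consecutive integers; the element
   i : 'I_N represents the integer i - off *)
Definition subsets_idx (N m : nat) := {A : {set 'I_N} | #|A| == m}.

(* epsilon_s(I) = (-1)^#{i in I | i < s}; s : 'I_N.+1 represents s - off too *)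
Definition eps_sub (N : nat) (I : {set 'I_N}) (s : 'I_N.+1) : K :=
  (-1) ^+ #|[set i in I | (val i < val s)%N]|.

(* Generic entry: for I, J m-subsets of [-off, N-1-off] (represented in 'I_N),
   c := N - off is the top element added; the universe 'I_N.+1 represents
   [-off, N - off].  Entry = eps_s(I) * bet s if I u {c} = (J+1) u {s},
   and 0 otherwise. *)
Definition Tentry (N : nat) (off : int) (bet : int -> K)
    (I J : {set 'I_N}) : K :=
  let IA : {set 'I_N.+1} := ord_max |: [set widen_ord (leqnSn N) i | i in I] in
  let J1 : {set 'I_N.+1} := [set lift ord0 j | j in J] in
  match [pick s : 'I_N.+1 | IA == s |: J1] with
  | Some s => eps_sub I s * bet (Posz (val s) - off)
  | None => 0
  end.

Definition Tmat (N m : nat) (off : int) (bet : int -> K) :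
    'M[K]_#|{: subsets_idx N m}| :=
  \matrix_(i, j) Tentry off bet (val (enum_val i)) (val (enum_val j)).

(* bold T: indexed by a-subsets of [-b, a-1] *)
Definition Tbold (S : seq int) (w : int -> K) (a b : nat) :=
  Tmat (a + b) a (Posz b) (beta S w).

(* bold T~: indexed by (a-1)-subsets of [-b-1, a-2] *)
Definition Ttilde (S : seq int) (w : int -> K) (a b : nat) :=
  Tmat (a + b) (a - 1) (Posz b + 1) (betat S w).

Definition detpoly n (M : 'M[K]_n) : {poly K} :=
  \det (1%:M - 'X *: map_mx polyC M).

Definition Dpoly S w a b := detpoly (Tbold S w a b).
Definition Dtpoly S w a b := detpoly (Ttilde S w a b).

Definition Aplus (S : seq int) (w : int -> K) (k : nat) : 'M[K]_(k./2.+1) :=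
  \matrix_(i, j)
    (if (2 * j < k)%N
     then omega S w (Posz j - Posz i) + omega S w (Posz k - Posz j - Posz i)
     else omega S w (Posz j - Posz i)).

(* A_k^- : indices 0 <= i, j < k/2, i.e. i, j < uphalf k *)
Definition Aminus (S : seq int) (w : int -> K) (k : nat) : 'M[K]_(uphalf k) :=
  \matrix_(i, j)
    (omega S w (Posz j - Posz i) - omega S w (Posz k - Posz j - Posz i)).

Definition Fplus S w (k : nat) : K :=
  if k is k'.+1 then \det (1%:M - Aplus S w k') else 1.
Definition Fminus S w (k : nat) : K :=
  if k is k'.+1 then \det (1%:M - Aminus S w k') else 1.

Definition cof0 (n : nat) : 'M[K]_n -> nat -> K :=
  match n return 'M[K]_n -> nat -> K with
  | 0 => fun _ _ => 0
  | n'.+1 => fun M l => cofactor M (inord l) ord0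
  end.

Definition Fplus_cof S w (k l : nat) : K := cof0 (1%:M - Aplus S w k) l.
Definition Fminus_cof S w (k l : nat) : K := cof0 (1%:M - Aminus S w k) l.

Definition Gplus S w (k : nat) : {poly K} :=
  \sum_(l < k./2.+1) Fplus_cof S w k l *: 'X^l.
Definition Gminus S w (k : nat) : {poly K} :=
  \sum_(l < uphalf k) Fminus_cof S w k l *: 'X^l.

End Defs.

(* Formal power series identity  sum_k f_k z^k = Num(z)/Den(z), expressed as
   Den(z) * sum_k f_k z^k = Num(z) coefficientwise (Den has constant term 1
   in all uses, so this is the same as the identity in R[[z]]). *)
Definition series_ratio (R : comNzRingType) (Num Den : {poly R}) (f : nat -> R) :=
  forall k : nat, \sum_(i < k.+1) Den`_i * f (k - i)%N = Num`_k.

Definition Dz2 (K : fieldType) S w a b : {poly K} := Dpoly S w a b \Po 'X^2.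

(* D~(u z^2) D(z^2) in K[u][z]: outer variable z, inner variable u *)
Definition Den2 (K : fieldType) S w a b : {poly {poly K}} :=
  (map_poly polyC (Dtpoly S w a b) \Po ('X^2 * ('X : {poly K})%:P))
  * map_poly polyC (Dz2 S w a b).

(* Main.v *)
Require Import Defs.
From HB Require Import structures.
From mathcomp Require Import all_boot all_order all_algebra.
From mathcomp Require Import zify.
Import Order.TTheory GRing.Theory Num.Theory.
Set Implicit Arguments. Unset Strict Implicit. Unset Printing Implicit Defensive.
Local Open Scope ring_scope.

(** For [k = 2(n + a) + r] the matrix [1 - A_k] consists of [n] rows of the
    Toeplitz matrix [beta_(j - i)] above a boundary block that depends on [r]
    only.  Allow the first [a] columns to be any [a]-subset [I] of [[-b, a - 1]]:
    expanding the minors so obtained along the first row gives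
    [V_(n+1) = T V_n].  In the same way the sums [H_n] of [(-u)^l] times the
    minors without column 0 and row [l] satisfy [H_(n+1) = u T~ H_n + R V_n] with
    a constant matrix [R], where the terms [l > 0] give [u T~ H_n] and the term
    [l = 0] gives [R V_n].  An orbit [v_(n+1) = B v_n] has a generating function
    with denominator [det(1 - z B)], and for the block triangular matrix of
    [(H_n, V_n)] this determinant is [D~(u z) D(z)]. *)

(** * Rational generating functions and linear recursions *)

Definition rational (R : comNzRingType) (P : {poly R}) (f : nat -> R) :=
  exists Num, series_ratio Num P f.

Definition rdet (R : comNzRingType) n (B : 'M[R]_n) : {poly R} :=
  \det (1%:M - 'X *: map_mx polyC B).

(* The numerator is the entry of [adj(1 - X B) v_0]. *)
Lemma rational_orbit (R : comNzRingType) n (B : 'M[R]_n) (v : nat -> 'cV[R]_n) i :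
  (forall k, v k.+1 = B *m v k) -> rational (rdet B) (fun k => v k i 0).
Proof.
move=> vS; set M := 1%:M - 'X *: map_mx polyC B.
pose W := \adj M *m map_mx polyC (v 0).
have eqW : W = rdet B *: map_mx polyC (v 0) + 'X *: (map_mx polyC B *m W).
  apply/eqP; rewrite -subr_eq; apply/eqP.
  transitivity (M *m W); first by rewrite mulmxBl mul1mx -scalemxAl.
  by rewrite mulmxA mul_mx_adj mul_scalar_mx.
have coefW k j : (W j 0)`_k = (rdet B)`_k * v 0%N j 0 +
    (if k is k'.+1 then \sum_l B j l * (W l 0)`_k' else 0).
  rewrite {1}eqW !mxE coefD coefMC coefXM; congr (_ + _); case: k => //= k.
  by rewrite coef_sum; apply: eq_bigr => l _; rewrite !mxE coefCM.
(* The convolution of [rdet B] with [v] obeys the recursion [coefW]: its last term is a coefficient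
   of [rdet B] times [v 0], and [vS] extracts a factor [B] from all others. *)
exists (W i 0) => k; elim: k i => [|k IHk] i.
  by rewrite coefW big_ord1 subnn addr0.
rewrite coefW big_ord_recr /= subnn addrC; congr (_ + _).
transitivity (\sum_(t < k.+1) \sum_l B i l * ((rdet B)`_t * v (k - t)%N l 0)).
  apply: eq_bigr => t _; rewrite subSn -1?ltnS // vS mxE big_distrr /=.
  by apply: eq_bigr => l _; rewrite mulrCA.
rewrite exchange_big; apply: eq_bigr => l _; rewrite -IHk.
by rewrite big_distrr.
Qed.

(** Prepending [f 0] only changes the numerator, to ['X * Num' + f 0 * P]. This allows recursions
    that start late. *)
Lemma rational_shift (R : comNzRingType) (P : {poly R}) (f : nat -> R) m :
  rational P (fun k => f (k + m)%N) -> rational P f.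
Proof.
elim: m f => [|m IHm] f [Num Pf].
  by exists Num => k; rewrite -Pf; apply: eq_bigr => i _; rewrite addn0.
have [|Num' Pf'] := IHm (fun k => f k.+1).
  by exists Num => k; rewrite -Pf; apply: eq_bigr => i _; rewrite addnS.
exists ('X * Num' + (f 0%N)%:P * P) => k; rewrite coefD coefXM coefCM.
case: k => [|k] /=; first by rewrite big_ord1 add0r mulrC.
rewrite big_ord_recr /= subnn mulrC -Pf'; congr (_ + _).
by apply: eq_bigr => i _; rewrite subSn // -ltnS.
Qed.

Lemma sum_comp_poly_X2 (R : comNzRingType) (P : {poly R}) (f : nat -> R) k :
  \sum_(i < k.+1) (P \Po 'X^2)`_i * f (k - i)%N =
  \sum_(i < k./2.+1) P`_i * f (k - i.*2)%N.
Proof.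
have odd0 i : odd i -> (P \Po 'X^2)`_i = 0.
  by move=> oi; rewrite coef_comp_poly_Xn // dvdn2 oi.
rewrite (bigID (fun i : 'I__ => odd i)) /= big1 ?add0r; last first.
  by move=> i oi; rewrite odd0 // mul0r.
have lt2 (i : 'I_k./2.+1) : (i.*2 < k.+1)%N by have := ltn_ord i; lia.
have lt1 (i : 'I_k.+1) : (i./2 < k./2.+1)%N by have := ltn_ord i; lia.
rewrite (reindex (fun i : 'I_k./2.+1 => Ordinal (lt2 i))) /=; last first.
  exists (fun i => Ordinal (lt1 i)) => i; rewrite inE /= => oi; apply: val_inj => /=; lia.
apply: eq_big => [i|i _]; first by rewrite odd_double.
by rewrite coef_comp_poly_Xn // dvdn2 odd_double /= divn2 doubleK.
Qed.

(** A denominator in [z^2] never mixes the even and the odd terms of [f]. *)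
Lemma rational_parity (R : comNzRingType) (P : {poly R}) (f : nat -> R) :
  (forall r : bool, rational P (fun k => f (k.*2 + r)%N)) ->
  rational (P \Po 'X^2) f.
Proof.
move=> Pf; have [N1 P1] := Pf true; have [N0 P0] := Pf false.
(* This is [N0(z^2) + z N1(z^2)]. *)
exists (\poly_(k < (maxn (size N0) (size N1)).*2)
          (if odd k then N1`_k./2 else N0`_k./2)) => k.
transitivity (if odd k then N1`_k./2 else N0`_k./2); last first.
  rewrite coef_poly; case: ltnP => // lek.
  have := leq_maxl (size N0) (size N1); have := leq_maxr (size N0) (size N1).
  move: (maxn _ _) lek => M lek le1 le0.
  by case: odd; rewrite nth_default //; [apply: leq_trans le1 _|apply: leq_trans le0 _]; lia.
rewrite sum_comp_poly_X2; case ok: (odd k); [rewrite -P1|rewrite -P0];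
  by apply: eq_bigr => i _; congr (_ * f _); have := ltn_ord i; lia.
Qed.

(** * Minors with selected columns and their expansion along the first row *)

Definition minor (R : comNzRingType) m (e : nat -> nat -> R) (s : seq nat) : R :=
  \det (\matrix_(i < m, j < m) e i (nth 0%N s j)).

Definition cols (P : pred nat) (L : nat) : seq nat := [seq p <- iota 0 L | P p].

Lemma eq_minor (R : comNzRingType) m (e e' : nat -> nat -> R) s :
  (forall i p, (i < m)%N -> e i p = e' i p) -> minor m e s = minor m e' s.
Proof. by move=> ee'; congr (\det _); apply/matrixP => i j; rewrite !mxE ee'. Qed.

Lemma minor_expand (R : comNzRingType) m (e : nat -> nat -> R) s :
  size s = m.+1 -> uniq s ->
  minor m.+1 e s =
  \sum_(x <- s) (-1) ^+ index x s * e 0%N x * minor m (fun i => e i.+1) (rem x s).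
Proof.
move=> sz_s us; rewrite (big_nth 0%N) sz_s big_mkord /minor (expand_det_row _ ord0).
apply: eq_bigr => j _; have ltj : (j < size s)%N by rewrite sz_s.
rewrite mxE index_uniq // /cofactor add0n mulrCA -mulrA; congr (_ * (_ * \det _)).
apply/matrixP => i k; rewrite !mxE lift0 remE index_uniq //.
congr (e _ _); rewrite nth_cat size_take_min /= /bump.
have -> : minn j (size s) = j by apply/minn_idPl/ltnW.
case: ltnP => lekj; first by rewrite nth_take.
by rewrite nth_drop addSn subnKC.
Qed.

(** The position of a selected column [x] is the number of selected columns before it, so the
    cofactor sign becomes [epsilon_x]. *)
Lemma minor_cols_expand (R : comNzRingType) m (e : nat -> nat -> R) P L :
  size (cols P L) = m.+1 ->
  minor m.+1 e (cols P L) =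
  \sum_(x < L | P x) (-1) ^+ count P (iota 0 x) * e 0%N x *
     minor m (fun i => e i.+1) (cols (fun p => P p && (p != x)) L).
Proof.
move=> sz; have uc : uniq (cols P L) by rewrite filter_uniq ?iota_uniq.
rewrite minor_expand // big_filter (_ : iota 0 L = index_iota 0 L) ?big_mkord; last first.
  by rewrite /index_iota subn0.
apply: eq_bigr => x Px; congr ((-1) ^+ _ * _ * minor _ _ _); last first.
  by rewrite rem_filter // -filter_predI; apply: eq_filter => p /=; rewrite andbC.
move: (val x) (ltn_ord x) Px => y lty Py.
rewrite /cols -(subnKC (ltnW lty)) iotaD filter_cat index_cat.
rewrite mem_filter mem_iota ltnn !andbF add0n size_filter.
case E: (L - y)%N => [|d]; first by lia.
by rewrite /= Py /= eqxx addn0.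
Qed.

(** If selected, column 0 is the first column of the minor and vanishes; otherwise all column labels
    drop by one. *)
Lemma minor_cols_shift (R : comNzRingType) m (e : nat -> nat -> R) P L :
  size (cols P L.+1) = m -> (forall i, (i < m)%N -> e i 0%N = 0) ->
  minor m e (cols P L.+1) =
  if P 0%N then 0 else minor m (fun i p => e i p.+1) (cols (fun p => P p.+1) L).
Proof.
have colsE : cols P L.+1 = (if P 0%N then [:: 0%N] else [::]) ++
    map S (cols (fun p => P p.+1) L).
  by rewrite /cols /= (iotaDl 1 0 L) filter_map; case: ifP.
rewrite colsE; case P0: (P 0%N) => /= sz e0.
  case: m sz e0 => // m _ e0; rewrite /minor (expand_det_col _ ord0) big1 // => i _.
  by rewrite mxE e0 ?mul0r.
congr (\det _); apply/matrixP => i j; rewrite !mxE (nth_map 0%N) //.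
by rewrite -(size_map S) sz.
Qed.

(** When 0 is not left over, this is the set [J] for which [J + 1] is [P] without [x], as in the
    definition of [T]. *)
Definition down (P : pred nat) (x : nat) : pred nat :=
  fun p => P p.+1 && (p.+1 != x).

(** The band ends at column [N], which bounds [x]. Below row 0 column 0 vanishes, so a term can be
    nonzero only if column 0 is unselected or equals the removed [x]. *)
Lemma minor_step (R : comNzRingType) m (e : nat -> nat -> R) (c : nat -> R) P L N :
  size (cols P L.+1) = m.+1 -> (N <= L)%N ->
  (forall x, (x <= L)%N -> e 0%N x = if (x <= N)%N then c x else 0) ->
  (forall i, (i < m)%N -> e i.+1 0%N = 0) ->
  minor m.+1 e (cols P L.+1) =
  \sum_(x < N.+1 | P x) (-1) ^+ count P (iota 0 x) * c x *
    (if P 0%N && (0%N != x) then 0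
     else minor m (fun i p => e i.+1 p.+1) (cols (down P x) L)).
Proof.
move=> sz leNL e0 eS; rewrite minor_cols_expand //.
rewrite (big_ord_widen_cond L.+1 P (fun x => (-1) ^+ count P (iota 0 x) * c x *
    (if P 0%N && (0%N != x) then 0
     else minor m (fun i p => e i.+1 p.+1) (cols (down P x) L)))) ?ltnS //.
rewrite [RHS]big_mkcondr; apply: eq_bigr => x Px.
rewrite ltnS e0; last by rewrite -ltnS.
case: ifP => _; last by rewrite mulr0 mul0r.
congr (_ * _); apply: (minor_cols_shift (e := fun i => e i.+1)) => //.
have -> : cols (fun p => P p && (p != x)) L.+1 = rem (val x) (cols P L.+1).
  rewrite rem_filter ?filter_uniq ?iota_uniq // -filter_predI.
  by apply: eq_filter => p /=; rewrite andbC.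
by rewrite size_rem ?sz // mem_filter Px mem_iota add0n ltn_ord.
Qed.

(** * Subsets as column sets *)

(* The columns of a minor attached to [I]: the elements of [I], then every
   [p >= N], on which [insub] gives [None]. *)
Definition colset N (I : {set 'I_N}) : pred nat :=
  fun p => if insub p is Some i then i \in I else true.

Lemma colset_ord N (I : {set 'I_N}) (i : 'I_N) : colset I i = (i \in I).
Proof. by rewrite /colset valK. Qed.

Lemma colset_ge N (I : {set 'I_N}) p : (N <= p)%N -> colset I p.
Proof. by move=> leNp; rewrite /colset insubF // ltnNge leNp. Qed.

Definition addtop N (I : {set 'I_N}) : {set 'I_N.+1} :=
  ord_max |: [set widen_ord (leqnSn N) i | i in I].

Definition shift1 N (J : {set 'I_N}) : {set 'I_N.+1} := [set lift ord0 j | j in J].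

(** [colset I] contains every [p >= N], in particular the adjoined top element. *)
Lemma in_addtop N (I : {set 'I_N}) x : (x \in addtop I) = colset I x.
Proof.
have [ltxN|leNx] := ltnP x N; last first.
  rewrite colset_ge // !inE; apply/orP; left; apply/eqP/val_inj => /=.
  by have := ltn_ord x; lia.
rewrite (colset_ord I (Ordinal ltxN)) !inE -val_eqE /= ltn_eqF //=.
rewrite (_ : (x \in _) = (widen_ord (leqnSn N) (Ordinal ltxN) \in
    [set widen_ord (leqnSn N) i | i in I])); last first.
  by rewrite (_ : widen_ord _ (Ordinal ltxN) = x) //; apply: val_inj.
by rewrite mem_imset // => i j /(congr1 val) /= /val_inj.
Qed.

Lemma lift_in_shift1 N (J : {set 'I_N}) j : (lift ord0 j \in shift1 J) = (j \in J).
Proof. by rewrite mem_imset //; apply: lift_inj. Qed.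

Lemma ord0_in_shift1 N (J : {set 'I_N}) : (ord0 \in shift1 J) = false.
Proof. by apply/imsetP => -[j _ /(congr1 val)]. Qed.

Lemma card_addtop N (I : {set 'I_N}) : #|addtop I| = #|I|.+1.
Proof.
rewrite cardsU1 card_imset; last by move=> i j /(congr1 val) /= /val_inj.
by case: imsetP => // -[i _ /(congr1 val) /= eN]; have := ltn_ord i; lia.
Qed.

Lemma card_shift1 N (J : {set 'I_N}) : #|shift1 J| = #|J|.
Proof. by rewrite card_imset //; apply: lift_inj. Qed.

(** Counting elements forces [s] outside [J + 1], so [s] can be removed from both sides. *)
Lemma addtop_eqP N (I J : {set 'I_N}) s : #|I| = #|J| ->
  reflect (s \in addtop I /\ shift1 J = addtop I :\ s) (addtop I == s |: shift1 J).
Proof.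
move=> eqIJ; apply: (iffP eqP) => [E|[sI ->]]; last by rewrite setD1K.
have sJ : s \notin shift1 J.
  apply/negP => sJ; have := card_addtop I.
  by rewrite E cardsU1 sJ add0n card_shift1 -eqIJ; lia.
by rewrite E setU11 setU1K.
Qed.

Lemma eps_subE (K : fieldType) N (I : {set 'I_N}) (s : 'I_N.+1) :
  eps_sub K I s = (-1) ^+ count (colset I) (iota 0 s).
Proof.
congr (_ ^+ _); rewrite -sum1_count (_ : iota 0 s = index_iota 0 s); last first.
  by rewrite /index_iota subn0.
rewrite big_mkord (big_ord_widen_cond N (colset I) (fun=> 1%N)) ?sum1_card //; last by rewrite -ltnS.
by apply: eq_card => i; rewrite [LHS]inE -colset_ord.
Qed.

(** * The action of [T] on functions of column sets *)

Section Transfer.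
Variables (K : fieldType) (N m : nat) (off : int) (bet : int -> K).

(** At most one [s] is admissible, because [J + 1] is [addtop I] without [s]. As a sum, the entry
    can be interchanged with the sum over [J]. *)
Lemma TentryE (I J : {set 'I_N}) : #|I| = #|J| ->
  Tentry off bet I J = \sum_(s | addtop I == s |: shift1 J)
    (-1) ^+ count (colset I) (iota 0 s) * bet (Posz s - off).
Proof.
move=> eqIJ; rewrite /Tentry -/(addtop I) -/(shift1 J).
case: pickP => [s Es|no]; last by rewrite big_pred0.
rewrite (big_pred1 s) ?eps_subE // => t; apply/idP/eqP => [Et|->//].
have /(addtop_eqP _ eqIJ)[sI Js] := Es; have /(addtop_eqP _ eqIJ)[tI Jt] := Et.
apply/eqP/negPn/negP => nts.
have : t \in addtop I :\ s by rewrite in_setD1 nts.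
by rewrite -Js Jt setD11.
Qed.

Variables (V : lmodType K) (Phi : pred nat -> V).
Hypothesis eqPhi : forall P Q, P =1 Q -> Phi P = Phi Q.

(** Given [I] and [s], the only candidate [J] has [J + 1] equal to [addtop I] without [s]. It exists
    when [s] lies in [addtop I] and 0 is not left over, as [J + 1] omits 0. *)
Lemma Tentry_fiber (I : subsets_idx N m) (s : 'I_N.+1) :
  \sum_(J : subsets_idx N m | addtop (val I) == s |: shift1 (val J))
     Phi (colset (val J)) =
  if colset (val I) s then
    if colset (val I) 0%N && (0%N != s) then 0 else Phi (down (colset (val I)) s)
  else 0.
Proof.
case: I => I /= cI; have eqIJ (J : subsets_idx N m) : #|I| = #|val J|.
  by rewrite (eqP cI) (eqP (valP J)).
case: ifP => [sI|nsI]; last first.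
  rewrite big_pred0 // => J; apply/negP => /(addtop_eqP _ (eqIJ J))[].
  by rewrite in_addtop nsI.
case: ifP => [/andP[I0 s0]|I0s].
  rewrite big_pred0 // => J; apply/negP => /(addtop_eqP _ (eqIJ J))[_].
  move/setP/(_ ord0); rewrite ord0_in_shift1 2!inE in_addtop I0 -val_eqE /=.
  by rewrite s0.
pose J0 := [set j : 'I_N | lift ord0 j \in addtop I :\ s].
have J0E : shift1 J0 = addtop I :\ s.
  apply/setP => x; have [j ->|->] := unliftP ord0 x.
    by rewrite lift_in_shift1 [LHS]inE.
  by rewrite ord0_in_shift1 2!inE in_addtop -val_eqE /= andbC I0s.
have cJ0 : #|J0| == m.
  have := card_addtop I; rewrite (cardsD1 s) in_addtop sI (eqP cI) -J0E card_shift1.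
  by rewrite add1n => -[->].
rewrite (big_pred1 (exist _ J0 cJ0)) /= => [|J]; last first.
  apply/(addtop_eqP _ (eqIJ J))/eqP => [[_ JE]|-> /=].
    apply: val_inj => /=; apply/setP => j.
    by rewrite -lift_in_shift1 JE [RHS]inE.
  by rewrite in_addtop.
apply: eqPhi => p; rewrite /down.
(* For [p >= N] both sides hold, since [s <= N < p + 1]. *)
have [ltp|lep] := ltnP p N; last first.
  rewrite !colset_ge //; last by lia.
  by have := ltn_ord s; case: eqP => //; lia.
rewrite (colset_ord J0 (Ordinal ltp)) [LHS]inE in_setD1 in_addtop -val_eqE.
by rewrite [val _]lift0 andbC.
Qed.

(** The right side has the shape of [minor_step], so expansion along the first row amounts to
    applying [Tmat]. The module [V] will be [K] for full minors and [{poly K}] for cofactor sums. *)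
Lemma Tmat_sum (i : 'I_#|{: subsets_idx N m}|) (I := val (enum_val i)) :
  \sum_j Tmat N m off bet i j *: Phi (colset (val (enum_val j))) =
  \sum_(x < N.+1 | colset I x)
    ((-1) ^+ count (colset I) (iota 0 x) * bet (Posz x - off)) *:
    (if colset I 0%N && (0%N != x) then 0 else Phi (down (colset I) x)).
Proof.
transitivity (\sum_(J : subsets_idx N m) Tentry off bet I (val J) *: Phi (colset (val J))).
  by rewrite [RHS]big_enum_val; apply: eq_bigr => j _; rewrite mxE.
under eq_bigr => J _.
  rewrite TentryE; last by rewrite (eqP (valP (enum_val i))) (eqP (valP J)).
  rewrite scaler_suml big_mkcond; over.
rewrite exchange_big [RHS]big_mkcond /=; apply: eq_bigr => s _.
rewrite -big_mkcond -scaler_sumr Tentry_fiber -/I.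
by case: ifP => // _; rewrite scaler0.
Qed.
End Transfer.

Lemma eq_cols P Q L : P =1 Q -> cols P L = cols Q L.
Proof. by move=> PQ; apply: eq_filter. Qed.

Lemma size_cols_colset N (I : {set 'I_N}) n q :
  size (cols (colset I) (n + (N + q))) = (n + (#|I| + q))%N.
Proof.
rewrite addnCA /cols iotaD filter_cat size_cat addnCA add0n; congr (_ + _)%N.
  rewrite size_filter -sum1_count (_ : iota 0 N = index_iota 0 N); last first.
    by rewrite /index_iota subn0.
  by rewrite big_mkord -sum1_card; apply: eq_bigl => i; rewrite colset_ord.
rewrite (eq_in_filter (a2 := predT)) ?filter_predT ?size_iota // => p.
by rewrite mem_iota => /andP[/(colset_ge I) -> _].
Qed.

(** * Recursions for the minors and the cofactor sums *)

Section Recursion.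
(** Here [a] is one less than in the theorem: [T] lives on [a.+1]-subsets and [T~] on [a]-subsets.
    The number [q] adjusts the matrix order to the parity of [k]. *)
Variables (K : fieldType) (N a q : nat) (off : int) (bet bett : int -> K).
Variable e : nat -> nat -> nat -> K.
Hypothesis bettE : forall x : nat, bett (Posz x - (off + 1)) = - bet (Posz x - off).
Hypothesis e_top : forall n x, (x <= n + (N + q))%N ->
  e n.+1 0%N x = if (x <= N)%N then bet (Posz x - off) else 0.
Hypothesis e_shift : forall n i p, e n.+1 i.+1 p.+1 = e n i p.
Hypothesis e_left : forall n i, (i < n + (a.+1 + q))%N -> e n.+1 i.+1 0%N = 0.

Definition Vminor n P := minor (n + (a.+1 + q)) (e n) (cols P (n + (N + q))).

Definition Vcol n : 'cV[K]_#|{: subsets_idx N a.+1}| :=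
  \col_i Vminor n (colset (val (enum_val i))).

Lemma Vcol_step n : Vcol n.+1 = Tmat N a.+1 off bet *m Vcol n.
Proof.
apply/colP => i; rewrite !mxE; set I := val (enum_val i).
have cI : #|I| = a.+1 by rewrite (eqP (valP (enum_val i))).
transitivity (\sum_j Tmat N a.+1 off bet i j *:
    (Vminor n (colset (val (enum_val j))) : K^o)); last first.
  by apply: eq_bigr => j _; rewrite [Vcol n j 0]mxE.
rewrite (Tmat_sum off bet (Phi := fun P => Vminor n P : K^o)) => [|P Q PQ]; last first.
  by rewrite /Vminor (eq_cols _ PQ).
rewrite -/I /Vminor !addSn (@minor_step _ _ (e n.+1) (fun x => bet (Posz x - off)) _ _ N).
- apply: eq_bigr => x _; congr (_ * _); case: ifP => // _.
  by apply: eq_minor => k p _; rewrite e_shift.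
- by rewrite -addSn size_cols_colset cI.
- by lia.
- by move=> x; apply: e_top.
- by move=> k; apply: e_left.
Qed.

(** [bump l] skips row [l]; the deleted column 0 is accounted for by column sets with one element
    fewer. *)
Definition Hminor n l P :=
  minor (n + (a + q)) (fun i => e n (bump l i)) (cols P (n + (N + q))).

Definition Hsum n P : {poly K} :=
  \sum_(l < n + (a.+1 + q)) ((-1) ^+ l * Hminor n l P) *: 'X^l.

Definition Hcol n : 'cV[{poly K}]_#|{: subsets_idx N a}| :=
  \col_i Hsum n (colset (val (enum_val i))).

(** If 0 is not in [I], then [drop0 I + 1] is [I] with the top element [N] adjoined, hence one
    element larger than [I]. *)
Definition drop0 (I : {set 'I_N}) : {set 'I_N} := [set j : 'I_N | colset I j.+1].

(** This is the constant matrix [R] coming from the term [l = 0]. *)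
Definition HVmat : 'M[{poly K}]_(#|{: subsets_idx N a}|, #|{: subsets_idx N a.+1}|) :=
  \matrix_(i, j) (~~ colset (val (enum_val i)) 0%N &&
                  (drop0 (val (enum_val i)) == val (enum_val j)))%:R.

Lemma eq_drop0 (I : {set 'I_N}) : colset (drop0 I) =1 (fun p => colset I p.+1).
Proof.
move=> p; have [ltp|lep] := ltnP p N; last by rewrite !colset_ge //; lia.
by rewrite (colset_ord _ (Ordinal ltp)) inE.
Qed.

Lemma card_drop0 (I : {set 'I_N}) : ~~ colset I 0%N -> #|drop0 I| = #|I|.+1.
Proof.
move=> I0; have := size_cols_colset I 1 0; rewrite addn0 add1n /cols /=.
rewrite (negbTE I0) (iotaDl 1 0 N) filter_map size_map addn0 add1n => <-.
have := size_cols_colset (drop0 I) 0 0; rewrite !addn0 !add0n => <-.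
by congr size; apply: eq_filter => p; rewrite eq_drop0.
Qed.

Lemma HVmat_mul n i : (HVmat *m map_mx polyC (Vcol n)) i 0 =
  if colset (val (enum_val i)) 0%N then 0
  else (Vminor n (fun p => colset (val (enum_val i)) p.+1))%:P.
Proof.
rewrite mxE; set I := val (enum_val i); case: ifPn => [I0|I0].
  by rewrite big1 // => j _; rewrite !mxE I0 mul0r.
have cI : #|drop0 I| == a.+1 by rewrite card_drop0 // (eqP (valP (enum_val i))).
rewrite (bigD1 (enum_rank (exist _ (drop0 I) cI : subsets_idx N a.+1))) //=.
rewrite big1 => [|j nj]; rewrite !mxE -/I I0.
  by rewrite enum_rankK /= eqxx mul1r addr0 /Vminor (eq_cols _ (eq_drop0 I)).
case: eqP => [Ej|_]; last by rewrite mul0r.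
by case/eqP: nj; apply: enum_val_inj; apply: val_inj; rewrite enum_rankK.
Qed.

(** Deleting row [l + 1] keeps row 0, and expansion along row 0 leaves a minor of level [n] with row
    [l] deleted. *)
Lemma Hcol_step n : Hcol n.+1 =
  ('X *: map_mx polyC (Tmat N a (off + 1) bett)) *m Hcol n
  + HVmat *m map_mx polyC (Vcol n).
Proof.
apply/colP => i; rewrite [RHS]mxE HVmat_mul [in LHS]mxE -scalemxAl [X in _ = X + _]mxE.
set I := val (enum_val i).
have cI : #|I| = a by rewrite (eqP (valP (enum_val i))).
have -> : (map_mx polyC (Tmat N a (off + 1) bett) *m Hcol n) i 0 =
    \sum_j Tmat N a (off + 1) bett i j *: Hsum n (colset (val (enum_val j))).
  by rewrite mxE; apply: eq_bigr => j _; rewrite [map_mx _ _ i j]mxE [Hcol n j 0]mxE mul_polyC.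
have eqH P Q : P =1 Q -> Hsum n P = Hsum n Q.
  by move=> PQ; apply: eq_bigr => l _; rewrite /Hminor (eq_cols _ PQ).
have sz : size (cols (colset I) (n + (N + q)).+1) = (n + (a + q)).+1.
  by rewrite -addSn size_cols_colset cI.
rewrite (Tmat_sum _ _ eqH) -/I {1}/Hsum addSn big_ord_recl addrC; congr (_ + _).
- have stepH (l : nat) : (l < n + (a.+1 + q))%N -> Hminor n.+1 l.+1 (colset I) =
      \sum_(x < N.+1 | colset I x) (-1) ^+ count (colset I) (iota 0 x) *
        bet (Posz x - off) *
        (if colset I 0%N && (0%N != x) then 0 else Hminor n l (down (colset I) x)).
    move=> ltl; rewrite /Hminor !addSn.
    rewrite (@minor_step _ _ _ (fun x => bet (Posz x - off)) _ _ N) //.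
    + apply: eq_bigr => x _; congr (_ * _); case: ifP => // _.
      by apply: eq_minor => k p _; rewrite bumpS e_shift.
    + by lia.
    + by move=> x; apply: e_top.
    + by move=> k ltk; rewrite bumpS e_left //; rewrite /bump; lia.
  under eq_bigr => l _ do rewrite lift0 stepH // big_distrr scaler_suml.
  rewrite exchange_big mulr_sumr; apply: eq_bigr => x _ /=.
  (* The extra factor [-u] of the term [l + 1] splits into ['X] and the sign in [bettE]. *)
  rewrite bettE; case: ifP => _.
    by rewrite big1 ?scaler0 ?mulr0 // => l _; rewrite !mulr0 scale0r.
  rewrite /Hsum -scalerAr mulr_sumr scaler_sumr; apply: eq_bigr => l _.
  rewrite -scalerAr -exprS scalerA; congr (_ *: _).
  by rewrite exprS mulN1r mulrN !mulNr mulrCA !mulrA.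
(* For [l = 0] row 0 is gone and column 0 vanishes, so a column shift alone leads to level [n]. *)
rewrite mul1r expr0 alg_polyC /Hminor addSn.
rewrite (@eq_minor _ _ _ (fun i => e n.+1 i.+1)) // minor_cols_shift //; last first.
  by move=> k ltk; rewrite e_left //; lia.
case: ifP => // _; congr (_%:P); rewrite /Vminor addSn addnS.
by apply: eq_minor => k p _; rewrite e_shift.
Qed.

End Recursion.

(** * Denominators of the generating functions *)

Lemma eq_rational (R : comNzRingType) (P : {poly R}) f g :
  f =1 g -> rational P f -> rational P g.
Proof.
by move=> fg [Num Pf]; exists Num => k; rewrite -Pf; apply: eq_bigr => i _; rewrite fg.
Qed.

Lemma rdet_block (R : comNzRingType) m n (A : 'M[R]_m) (B : 'M[R]_(m, n)) (C : 'M[R]_n) :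
  rdet (block_mx A B 0 C) = rdet A * rdet C.
Proof.
rewrite /rdet map_block_mx map_mx0 -(det_ublock _ (- ('X *: map_mx polyC B))); congr (\det _).
by rewrite scalar_mx_block scale_block_mx scaler0 opp_block_mx oppr0 add_block_mx addr0 add0r.
Qed.

Lemma rdet_map_polyC (R : comNzRingType) n (A : 'M[R]_n) :
  rdet (map_mx polyC A) = map_poly polyC (rdet A).
Proof.
rewrite /rdet -det_map_mx; congr (\det _); apply/matrixP => i j.
by rewrite !mxE rmorphB rmorphM /= map_polyX !map_polyC rmorph_nat.
Qed.

Lemma rdet_scaleX (R : comNzRingType) n (A : 'M[R]_n) :
  rdet ('X *: map_mx polyC A) =
  map_poly polyC (rdet A) \Po ('X * ('X : {poly R})%:P).
Proof.
rewrite -rdet_map_polyC /rdet -det_map_mx; congr (\det _); apply/matrixP => i j.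
rewrite !mxE [RHS]comp_polyB comp_polyM comp_polyX comp_polyC.
rewrite -polyC_natr comp_polyC.
by rewrite polyCM mulrA.
Qed.

(** The inhomogeneous recursion of [Hcol] becomes linear once [Vcol] is stacked below it. *)
Lemma rational_Hcol (K : fieldType) N a q off (bet bett : int -> K) e
    (i : 'I_#|{: subsets_idx N a}|) :
  (forall x : nat, bett (Posz x - (off + 1)) = - bet (Posz x - off)) ->
  (forall n x, (x <= n + (N + q))%N ->
     e n.+1 0%N x = if (x <= N)%N then bet (Posz x - off) else 0) ->
  (forall n i p, e n.+1 i.+1 p.+1 = e n i p) ->
  (forall n i, (i < n + (a.+1 + q))%N -> e n.+1 i.+1 0%N = 0) ->
  rational ((map_poly polyC (detpoly (Tmat N a (off + 1) bett))
               \Po ('X * ('X : {poly K})%:P))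
            * map_poly polyC (detpoly (Tmat N a.+1 off bet)))
    (fun n => Hcol N a q e n i 0).
Proof.
move=> bettE e_top e_shift e_left.
rewrite -rdet_scaleX -[map_poly _ _]rdet_map_polyC -(rdet_block _ (HVmat K N a)).
pose v n := col_mx (Hcol N a q e n) (map_mx polyC (Vcol N a q e n)).
apply: (eq_rational (f := fun n => v n (lshift _ i) 0)) => [n|].
  by rewrite /v col_mxEu.
apply: rational_orbit => n; rewrite /v mul_block_col mul0mx add0r.
by rewrite (Vcol_step e_top) // map_mxM (Hcol_step bettE e_top).
Qed.

(** * Determinants and cofactors as minors with consecutive columns *)

Lemma det_matrix_cast (R : comNzRingType) m m' (E : nat -> nat -> R) : m = m' ->
  \det (\matrix_(i < m, j < m) E i j) = \det (\matrix_(i < m', j < m') E i j).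
Proof. by move->. Qed.

Lemma sum_cof0 (K : fieldType) m m' (E : nat -> nat -> K) : m = m'.+1 ->
  \sum_(l < m) cof0 (\matrix_(i < m, j < m) E i j) l *: 'X^l =
  \sum_(l < m'.+1)
    ((-1) ^+ l * \det (\matrix_(i < m', j < m') E (bump l i) j.+1)) *: 'X^l.
Proof.
move->; apply: eq_bigr => l _; rewrite /= inord_val /cofactor addn0.
congr ((_ * \det _) *: _); apply/matrixP => i j; by rewrite !mxE lift0.
Qed.

Lemma cols_geq b m : cols (fun p => (b <= p)%N) (b + m) = iota b m.
Proof.
rewrite /cols iotaD filter_cat (eq_in_filter (a2 := pred0)) => [|p]; last first.
  by rewrite mem_iota add0n /=; lia.
rewrite filter_pred0 (eq_in_filter (a2 := predT)) ?filter_predT // => p.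
by rewrite mem_iota /=; lia.
Qed.

(** The starting column sets: [b = A] gives all columns of [1 - A_k], and [b = A.+1] all but column
    0. *)
Definition geset N b : {set 'I_N} := [set i : 'I_N | (b <= i)%N].

Lemma card_geset N b : #|geset N b| = (N - b)%N.
Proof.
have [leNb|ltbN] := leqP N b.
  rewrite (_ : geset N b = set0) ?cards0; first by lia.
  by apply/setP => i; rewrite !inE; have := ltn_ord i; lia.
have := size_cols_colset (geset N b) 0 0; rewrite !addn0 !add0n => <-.
rewrite -(size_iota b (N - b)) -cols_geq subnKC 1?ltnW //; congr size.
apply: eq_in_filter => p; rewrite mem_iota add0n => /= ltp.
by rewrite (colset_ord _ (Ordinal ltp)) inE.
Qed.

Lemma colset_geset N b : (b <= N)%N -> colset (geset N b) =1 (fun p => (b <= p)%N).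
Proof.
move=> lebN p; have [ltp|lep] := ltnP p N.
  by rewrite (colset_ord _ (Ordinal ltp)) inE.
by rewrite colset_ge //; lia.
Qed.

(** * A common form of [1 - A_k^+] and [1 - A_k^-] *)

Section Corner.
Variables (K : fieldType) (S : seq int) (w : int -> K) (a : nat).
Let A := a.+1.
Hypothesis S_bound : forall s, s \in S -> - Posz A <= s <= Posz A.
(** [dim k] is the order of [A_k], and [q r] is 1 for [A_k^+] and [r] for [A_k^-]. *)
Variables (g : int -> K) (dim : nat -> nat) (q : bool -> nat).
Hypothesis q_le1 : forall r, (q r <= 1)%N.
Hypothesis dimE : forall n (r : bool), dim ((n + A).*2 + r) = (n + (A + q r))%N.

(* The entries of [1 - A_k]; the factor [g (k - 2j)] is the sign of the second
   [omega], or 0 in the column [j = k/2] of [A_k^+]. *)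
Definition corner (k i j : int) : K :=
  beta S w (j - i) + g (k - j - j) * beta S w (k - j - i).

Definition corner_mx k : 'M[K]_(dim k) :=
  \matrix_(i, j) corner (Posz k) (Posz i) (Posz j).

(* Column [p] of a minor is column [p - A] of the matrix; both columns [-b] of
   [T] and [-b - 1] of [T~] become [p = 0]. *)
Let e r n i p := corner (Posz ((n + A).*2 + nat_of_bool r)) (Posz i) (Posz p - Posz A).

Lemma beta_out s : (s < - Posz A) || (Posz A < s) -> beta S w s = 0.
Proof.
move=> s_out; rewrite /beta /omega; case: ifP => [/S_bound|_]; first by lia.
by rewrite (_ : (s == 0) = false) ?subrr //; lia.
Qed.

(** In row 0 the index [k - j] exceeds [A], so only the Toeplitz term is left. *)
Let e_top r n x : (x <= n + (A + A + q r))%N ->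
  e r n.+1 0%N x = if (x <= A + A)%N then beta S w (Posz x - Posz A) else 0.
Proof.
move=> lex; have := q_le1 r => q1; rewrite /e /corner subr0.
rewrite [X in _ * X]beta_out ?mulr0 ?addr0; last by apply/orP; right; lia.
by case: leqP => // ltx; rewrite beta_out //; lia.
Qed.

(** Raising [n] by 1 raises [k] by 2, so [j - i], [k - 2j] and [k - j - i] are unchanged. *)
Let e_shift r n i p : e r n.+1 i.+1 p.+1 = e r n i p.
Proof.
by rewrite /e /corner; congr (beta _ _ _ + g _ * beta _ _ _); lia.
Qed.

(** Column [p = 0] means [j = -A]: below row 0, [j - i] is less than [-A] and [k - j - i] exceeds
    [A]. *)
Let e_left r n i : (i < n + (A + q r))%N -> e r n.+1 i.+1 0%N = 0.
Proof.
move=> lti; have := q_le1 r => q1; rewrite /e /corner.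
by rewrite !beta_out ?mulr0 ?addr0 //; apply/orP; [right|left]; lia.
Qed.

Lemma det_corner n (r : bool) :
  \det (corner_mx ((n + A).*2 + r)) =
  Vminor (A + A) a (q r) (e r) n (colset (geset (A + A) A)).
Proof.
rewrite /corner_mx.
rewrite (det_matrix_cast (fun i j => corner _ (Posz i) (Posz j)) (dimE n r)).
congr (\det _); apply/matrixP => i j; rewrite !mxE /e.
rewrite (eq_cols _ (colset_geset _)) ?leq_addr //.
rewrite (_ : n + (A + A + q r) = A + (n + (A + q r)))%N; last by lia.
by rewrite cols_geq nth_iota // [Posz (A + _)]PoszD addrAC subrr add0r.
Qed.

Lemma sum_cof_corner n (r : bool) :
  \sum_(l < dim ((n + A).*2 + r)) cof0 (corner_mx ((n + A).*2 + r)) l *: 'X^l =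
  Hsum (A + A) a (q r) (e r) n (colset (geset (A + A) A.+1)).
Proof.
rewrite /corner_mx (sum_cof0 (m' := n + (a + q r))
  (fun i j => corner _ (Posz i) (Posz j))); last by rewrite dimE /A; lia.
rewrite /Hsum (_ : (n + (a + q r)).+1 = n + (a.+1 + q r))%N; last by lia.
apply: eq_bigr => l _; congr ((_ * \det _) *: _); apply/matrixP => i j.
rewrite !mxE /e (eq_cols _ (colset_geset _)); last by rewrite /A; lia.
rewrite (_ : n + (A + A + q r) = A.+1 + (n + (a + q r)))%N; last by rewrite /A; lia.
by rewrite cols_geq nth_iota // (addSnnS A) [Posz (A + _)]PoszD addrAC subrr add0r.
Qed.

Lemma rational_det_corner (f : nat -> K) :
  (forall k, f k.+1 = \det (corner_mx k)) -> rational (Dz2 S w A A) f.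
Proof.
(* The description by minors starts at [k = 2A], and the determinant for [k] is [f (k + 1)]. *)
move=> fE; apply: (rational_shift (m := A.*2.+1)); apply: rational_parity => r.
have cI : #|geset (A + A) A| == a.+1 by rewrite card_geset addnK.
pose I : subsets_idx (A + A) a.+1 := exist _ (geset (A + A) A) cI.
apply: (eq_rational (f := fun n => Vcol (A + A) a (q r) (e r) n (enum_rank I) 0)).
  move=> n; rewrite mxE enum_rankK /= -det_corner addnS fE; congr (\det (corner_mx _)).
  by lia.
by apply: rational_orbit => n; apply: (Vcol_step (@e_top r) (@e_shift r) (@e_left r)).
Qed.

Lemma rational_cof_corner (f : nat -> {poly K}) :
  (forall k, f k = \sum_(l < dim k) cof0 (corner_mx k) l *: 'X^l) ->
  rational (Den2 S w A A) f.
Proof.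
move=> fE; apply: (rational_shift (m := A.*2)).
(* Both factors involve [z] only through [z^2], as the parity splitting requires. *)
have -> : Den2 S w A A =
    ((map_poly polyC (Dtpoly S w A A) \Po ('X * ('X : {poly K})%:P))
     * map_poly polyC (Dpoly S w A A)) \Po 'X^2.
  rewrite /Den2 /Dz2 comp_polyM -comp_polyA comp_polyM comp_polyX comp_polyC.
  by rewrite map_comp_poly map_polyXn.
apply: rational_parity => r.
have cI : #|geset (A + A) A.+1| == a by rewrite card_geset /A; lia.
pose I : subsets_idx (A + A) a := exist _ (geset (A + A) A.+1) cI.
apply: (eq_rational (f := fun n => Hcol (A + A) a (q r) (e r) n (enum_rank I) 0)).
  move=> n; rewrite mxE enum_rankK /= -sum_cof_corner fE.
  by rewrite (_ : n.*2 + r + A.*2 = (n + A).*2 + r)%N; last by lia.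
rewrite /Dtpoly /Ttilde subn1 /=.
apply: (rational_Hcol _ _ (@e_top r) (@e_shift r) (@e_left r)) => x.
by rewrite /betat; congr (- beta _ _ _); lia.
Qed.

End Corner.

(** * Application to [A_k^+] and [A_k^-] for symmetric [S] *)

Theorem mainTheorem13 (K : fieldType) (charK0 : [pchar K] =i pred0)
    (S : seq int) (w : int -> K) (a b : nat)
    (a_ge1 : (1 <= a)%N)
    (a_in : Posz a \in S) (a_max : forall s, s \in S -> s <= Posz a)
    (b_in : - Posz b \in S) (b_min : forall s, s \in S -> - Posz b <= s)
    (symS : forall s : int, (- s \in S) = (s \in S))
    (symw : forall s : int, s \in S -> w (- s) = w s) :
  exists (Np Nm : {poly K}) (Ntp Ntm : {poly {poly K}}),
    [/\ series_ratio Np (Dz2 S w a b) (Fplus S w),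
        series_ratio Nm (Dz2 S w a b) (Fminus S w),
        series_ratio Ntp (Den2 S w a b) (Gplus S w) &
        series_ratio Ntm (Den2 S w a b) (Gminus S w)].
Proof.
(* By symmetry [b] and [-a] lie in [S], and extremality gives both inequalities. *)
have eab : b = a.
  have := a_max (Posz b); rewrite -symS => /(_ b_in).
  by have := b_min (- Posz a); rewrite symS => /(_ a_in); lia.
case: a a_ge1 a_in a_max eab => // a _ _ a_max eab; subst b.
have S_bound s : s \in S -> - Posz a.+1 <= s <= Posz a.+1.
  by move=> sS; rewrite b_min ?a_max.
pose gp (t : int) : K := (0 < t)%R%:R.
pose gm (t : int) : K := -1.
pose dp k := k./2.+1.
have dpE n (r : bool) : dp ((n + a.+1).*2 + r)%N = (n + (a.+1 + 1))%N.
  by rewrite /dp; lia.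
have dmE n (r : bool) : uphalf ((n + a.+1).*2 + r)%N = (n + (a.+1 + r))%N by lia.
have cornerp k : 1%:M - Aplus S w k = corner_mx S w gp dp k.
  apply/matrixP => i j; rewrite !mxE /corner /gp /beta.
  have := ltn_ord i; have := ltn_ord j; rewrite /dp => ltj lti.
  rewrite (_ : (Posz j - Posz i == 0) = (i == j)); last by rewrite -val_eqE /=; lia.
  rewrite (_ : (0 < Posz k - Posz j - Posz j) = (2 * j < k)%N); last by lia.
  case: ifP => lt2j; last by rewrite mul0r addr0.
  (* Here [j < k/2] and [i <= k/2], so the index is positive and the second [beta] is [-omega]. *)
  rewrite (_ : (Posz k - Posz j - Posz i == 0) = false); last by lia.
  by rewrite mul1r sub0r opprD addrA.
have cornerm k : 1%:M - Aminus S w k = corner_mx S w gm uphalf k.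
  apply/matrixP => i j; rewrite !mxE /corner /gm /beta.
  have := ltn_ord i; have := ltn_ord j => ltj lti.
  rewrite (_ : (Posz j - Posz i == 0) = (i == j)); last by rewrite -val_eqE /=; lia.
  rewrite (_ : (Posz k - Posz j - Posz i == 0) = false); last by lia.
  by rewrite mulN1r sub0r opprK opprB addrA addrAC.
have leb1 (r : bool) : (r <= 1)%N by case: r.
have [||Np HNp] := @rational_det_corner K S w a S_bound gp dp (fun=> 1%N) _ dpE (Fplus S w).
- by [].
- by move=> k; rewrite -cornerp.
have [|Nm HNm] := @rational_det_corner K S w a S_bound gm uphalf nat_of_bool leb1 dmE (Fminus S w).
  by move=> k; rewrite -cornerm.
have [||Ntp HNtp] := @rational_cof_corner K S w a S_bound gp dp (fun=> 1%N) _ dpE (Gplus S w).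
- by [].
- by move=> k; rewrite -cornerp.
have [|Ntm HNtm] := @rational_cof_corner K S w a S_bound gm uphalf nat_of_bool leb1 dmE (Gminus S w).
  by move=> k; rewrite -cornerm.
by exists Np, Nm, Ntp, Ntm.
Qed.
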